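(* Let $\Delta$ and $\Delta_1\subset\Delta$ be affine root systems. Let $L$ and $L_1\subset L$ be the corresponding root lattices. Then $\Delta_1$ is a root subsystem of $\Delta$ if and only if $\Delta_1=\Delta\cap L_1$.
   Context: An affine root system is the root system (real and imaginary roots) of an affine Kac--Moody algebra, untwisted or twisted. Its root lattice is the $\mathbb Z$-span of its roots. A root system $\Delta_1\subset\Delta$ is called a root subsystem of $\Delta$ if it is closed with respect to addition: if $\alpha,\beta\in\Delta_1$ and $\alpha+\beta\in\Delta$, then $\alpha+\beta\in\Delta_1$. In terms of a set $\Pi_1$ of simple roots of $\Delta_1$, the criterion used is: $\Delta_1$ is a root subsystem of $\Delta$ if and only if $\alpha-\beta\notin\Delta$ for all $\alpha,\beta\in\Pi_1$. The ranks of $\Delta$ and $\Delta_1$ are not assumed equal. *)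

(* Defs.v *)
From HB Require Import structures.
From mathcomp Require Import all_boot all_order all_algebra.
From mathcomp Require Import boolp classical_sets.

Set Implicit Arguments.
Unset Strict Implicit.
Unset Printing Implicit Defensive.

Import Order.TTheory GRing.Theory Num.Theory.

Local Open Scope classical_set_scope.
Local Open Scope ring_scope.

(* Conventions are those of Kac, "Infinite dimensional Lie algebras":
   A i j = <alpha_i^vee, alpha_j>, and an element of the root lattice is the
   column x : 'cV[int]_n of its coordinates on the simple roots, so that
   <alpha_i^vee, x> = (A *m x) i 0 and alpha_i = delta_mx i 0. *)

Definition gcm n (A : 'M[int]_n) : Prop :=
  [/\ forall i, A i i = 2,
      forall i j, i != j -> A i j <= 0
    & forall i j, A i j = 0 -> A j i = 0].

Definition indecomposable n (A : 'M[int]_n) : Prop :=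
  forall I : {set 'I_n},
    (exists i, i \in I) -> (exists j, j \notin I) ->
    exists i j, [/\ i \in I, j \notin I & A i j != 0].

Definition rat_mx n (A : 'M[int]_n) : 'M[rat]_n := map_mx intr A.

(* Case (Aff) of Vinberg's trichotomy, which Kac takes as the definition of
   affine type.  Rational vectors suffice, as A is an integer matrix. *)
Definition affine_gcm n (A : 'M[int]_n) : Prop :=
  [/\ gcm A,
      indecomposable A,
      (\rank (rat_mx A)).+1 = n,
      exists2 u : 'cV[rat]_n, forall i, 0 < u i 0 & rat_mx A *m u = 0
    & forall v : 'cV[rat]_n,
        (forall i, 0 <= (rat_mx A *m v) i 0) -> rat_mx A *m v = 0].

Definition simple_refl n (A : 'M[int]_n) (i : 'I_n) (x : 'cV[int]_n) :
    'cV[int]_n :=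
  x - (A *m x) i 0 *: delta_mx i 0.

(* The orbit of the simple roots under the Weyl group, an element of which is
   given by a word in the simple reflections. *)
Definition real_root n (A : 'M[int]_n) : set 'cV[int]_n :=
  [set x | exists (w : seq 'I_n) (j : 'I_n),
             x = foldr (simple_refl A) (delta_mx j 0) w].

(* d is the imaginary root usually written delta. *)
Definition null_root n (A : 'M[int]_n) (d : 'cV[int]_n) : Prop :=
  [/\ A *m d = 0,
      forall i, 0 < d i 0
    & \big[gcdn/0%N]_i absz (d i 0) = 1%N].

Definition imaginary_root n (A : 'M[int]_n) : set 'cV[int]_n :=
  [set x | exists2 d, null_root A d & exists2 k : int, k != 0 & x = k *: d].

Definition km_roots n (A : 'M[int]_n) : set 'cV[int]_n :=
  real_root A `|` imaginary_root A.

Definition zcomb (V : zmodType) n (P : 'I_n -> V) (x : 'cV[int]_n) : V :=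
  \sum_i P i *~ x i 0.

Definition zfree (V : zmodType) n (P : 'I_n -> V) : Prop :=
  forall x, zcomb P x = 0 -> x = 0.

(* P is the family of simple roots.  Only the additive structure of the space
   that contains the roots is used, so V may be any abelian group. *)
Definition affine_root_system (V : zmodType) (Delta : set V) : Prop :=
  exists (n : nat) (A : 'M[int]_n) (P : 'I_n -> V),
    [/\ affine_gcm A, zfree P & Delta = zcomb P @` km_roots A].

Definition root_lattice (V : zmodType) (Delta : set V) : set V :=
  [set v | exists (m : nat) (r : 'I_m -> V) (c : 'I_m -> int),
             (forall i, Delta (r i)) /\ v = \sum_i r i *~ c i].

Definition root_subsystem (V : zmodType) (Delta Delta1 : set V) : Prop :=
  Delta1 `<=` Delta /\
  forall a b, Delta1 a -> Delta1 b -> Delta (a + b) -> Delta1 (a + b).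

(* Main.v *)
(* For the nontrivial direction, write a root x of L_1 as a sum of elements of
   Delta_1.  The root lattice of Delta carries a positive semidefinite
   Weyl-invariant form whose isotropic roots are the imaginary ones, and
   a - b is 0 or a root whenever (a, b) > 0 for roots a, b.  If x is real, some
   summand has a positive product with x and can be subtracted from it.  If x
   is imaginary, either all summands are imaginary, or a real summand has a
   negative product with another one, since its product with x is 0, and the
   two can be merged.  So induction on the number of summands applies. *)

Require Import Defs.
From HB Require Import structures.
From mathcomp Require Import all_boot all_order all_algebra.
From mathcomp Require Import boolp classical_sets.
From mathcomp Require Import ring lra.

Set Implicit Arguments.
Unset Strict Implicit.
Unset Printing Implicit Defensive.

Import Order.TTheory GRing.Theory Num.Theory.

Local Open Scope classical_set_scope.
Local Open Scope ring_scope.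

(** * Symmetrizability of affine Cartan matrices *)

Section Symmetrization.

Variables (n : nat) (A : 'M[int]_n) (u : 'I_n -> rat).
Hypotheses (A_gcm : gcm A) (A_ind : indecomposable A).
Hypotheses (u_gt0 : forall i, 0 < u i).
Hypothesis Au0 : forall i, \sum_j (A i j)%:~R * u j = 0.

(** Conjugating [A] by the diagonal matrix of [u] makes all row sums 0 and keeps the products
    [A i j * A j i], which are integers. *)
Let a i j : rat := (A i j)%:~R * u j / u i.
Let f (I : {set 'I_n}) : rat := \sum_(i in I) \sum_(j in I) a i j.

Let a_diag i : a i i = 2.
Proof. by case: A_gcm => A2 _ _; rewrite /a A2 mulfK // gt_eqF. Qed.

Let a_le0 i j : i != j -> a i j <= 0.
Proof.
case: A_gcm => _ A_le0 _ ij.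
by rewrite pmulr_lle0 ?invr_gt0 // pmulr_lle0 // lerz0 A_le0.
Qed.

(** Both entries are nonpositive and their product is a positive integer, so the inequality of
    arithmetic and geometric means gives the bound, and equality forces both to be -1. *)
Let edge i j : i != j -> A i j != 0 ->
  a i j + a j i <= -2 /\ (a i j + a j i = -2 -> a i j = a j i).
Proof.
move=> ij Aij; have [_ A_le0 A_sym0] := A_gcm.
have ji : j != i by rewrite eq_sym.
have prod_ge1 : 1 <= a i j * a j i.
  have -> : a i j * a j i = (A i j * A j i)%:~R.
    have ui := lt0r_neq0 (u_gt0 i); have uj := lt0r_neq0 (u_gt0 j).
    by rewrite /a intrM; field; rewrite ui uj.
  rewrite ler1z -[1]add0r lezD1 nmulr_rgt0.
    by rewrite lt_neqAle A_le0 // andbT; apply: contra Aij => /eqP/A_sym0 ->.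
  by rewrite lt_neqAle Aij A_le0.
have := a_le0 ij; have := a_le0 ji.
move: (a i j) (a j i) prod_ge1 => x y xy y_le0 x_le0.
have sq := sqr_ge0 (x - y).
have xy_le : x + y <= -2 by rewrite leNgt; apply/negP=> ?; nra.
split=> // xy2; have yE : y = - 2 - x by lra.
have : (x + 1) ^+ 2 <= 0 by rewrite yE in xy; nra.
by rewrite exprn_even_le0 //= => /eqP; rewrite yE; lra.
Qed.

Let a_eq0 i j : A i j = 0 -> a i j = 0.
Proof. by move=> Aij; rewrite /a Aij !mul0r. Qed.

Let pair_le0 i j : i != j -> a i j + a j i <= 0.
Proof. by move=> ij; rewrite -[leRHS]addr0 lerD ?a_le0 // eq_sym. Qed.

(** A full row of [a] sums to 0, and restricting it to [I] discards only nonpositive off-diagonal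
    entries. *)
Let f_ge0 I : 0 <= f I.
Proof.
apply: sumr_ge0 => i iI.
have := congr1 (fun x => x / u i) (Au0 i); rewrite mul0r mulr_suml => row0.
rewrite -[leLHS]row0 (bigID [in I]) /= gerDl sumr_le0 // => j jI.
by apply: a_le0; apply: contraNneq jI => <-.
Qed.

Let f_setU1 (I : {set 'I_n}) j : j \notin I ->
  f (j |: I) = f I + 2 + \sum_(i in I) (a i j + a j i).
Proof.
move=> jI; rewrite /f big_setU1 //= big_setU1 //= a_diag.
under [X in _ + X = _]eq_bigr do rewrite big_setU1 //=.
rewrite !big_split /=; ring.
Qed.

Let neighbour (I : {set 'I_n}) i j : j \notin I -> i \in I -> A i j != 0 ->
  f (j |: I) <= f I + 2 + (a i j + a j i).
Proof.
move=> jI iI Aij; rewrite f_setU1 // lerD2l (bigD1 i) //= gerDl sumr_le0 //.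
by move=> k /andP[kI _]; apply: pair_le0; apply: contraNneq jI => <-.
Qed.

(* Two edges from j to I close a cycle; the value of f on a cycle is at most
   0, so every estimate is an equality. *)
Let two_neighbours (I : {set 'I_n}) i k j :
  j \notin I -> i \in I -> k \in I -> i != k -> A i j != 0 ->
  A k j != 0 -> f I <= 2 -> f I = 2 /\ a i j = a j i.
Proof.
move=> jI iI kI ik Aij Akj fI.
have ij : i != j by apply: contraNneq jI => <-.
have kj : k != j by apply: contraNneq jI => <-.
have [e1 e1'] := edge ij Aij; have [e2 e2'] := edge kj Akj.
have := f_ge0 (j |: I); rewrite f_setU1 // (bigD1 i) //= (bigD1 k) /=;
  last first.
  by rewrite kI eq_sym.
set S := (X in _ + (_ + X)).
have S_le0 : S <= 0.
  apply: sumr_le0 => l /andP[/andP[lI _] _].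
  by apply: pair_le0; apply: contraNneq jI => <-.
by move=> f0; split; [lra | apply: e1'; lra].
Qed.

(* f is 2 on a single vertex, a new vertex adds 2 and each edge to it takes away
   at least 2, so f stays at most 2 as I grows, and 2 forces a tree with all
   edges symmetric. *)
Let symmetrized (I : {set 'I_n}) : Prop :=
  [/\ f I <= 2,
      exists2 d : 'I_n -> rat, forall i, 0 < d i
        & {in I &, forall i j, d i * (A i j)%:~R = d j * (A j i)%:~R}
    & f I = 2 -> {in I &, forall i j, a i j = a j i}].

Let symmetrized_by_u (I : {set 'I_n}) : {in I &, forall i j, a i j = a j i} ->
  exists2 d : 'I_n -> rat, forall i, 0 < d i
    & {in I &, forall i j, d i * (A i j)%:~R = d j * (A j i)%:~R}.
Proof.
(* Dividing [a i j] by [u i * u j] leaves [A i j / u i ^ 2], which is symmetric when [a] is. *)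
move=> a_sym; exists (fun i => (u i ^+ 2)^-1) => [i|i j iI jI].
  by rewrite invr_gt0 exprn_gt0.
have ui := lt0r_neq0 (u_gt0 i); have uj := lt0r_neq0 (u_gt0 j).
have := a_sym i j iI jI; rewrite /a => /(congr1 (fun x => x / (u i * u j))).
have -> : (A i j)%:~R * u j / u i / (u i * u j) = (u i ^+ 2)^-1 * (A i j)%:~R.
  by field; rewrite ui uj.
move=> ->.
by field; rewrite ui uj.
Qed.

Let sym_setU1 (T : eqType) (b : 'I_n -> 'I_n -> T) (I : {set 'I_n}) j :
  {in I &, forall i k, b i k = b k i} ->
  (forall i, i \in I -> b i j = b j i) ->
  {in j |: I &, forall i k, b i k = b k i}.
Proof.
move=> bI bj i k; rewrite !inE.
case/orP=> [/eqP->|iI] /orP[/eqP->|kI] //; last exact: bI.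
  by rewrite bj.
exact: bj.
Qed.

(** If [j] has a second neighbour in [I], then [f I = 2], so [a] is symmetric on [I] and on all
    edges to [j], and [u] symmetrizes. Otherwise [i0] is the only neighbour of [j] and the old [d]
    extends. *)
Let symmetrized_setU1 (I : {set 'I_n}) j i0 :
  j \notin I -> i0 \in I -> A i0 j != 0 ->
  symmetrized I -> symmetrized (j |: I).
Proof.
move=> jI i0I A0 [fI [d d_gt0 d_sym] a_sym].
have [_ A_le0 A_sym0] := A_gcm.
have A0' i : A i j = 0 -> a i j = a j i by move=> Aij; rewrite !a_eq0 // A_sym0.
have neq_j i : i \in I -> i != j by move=> iI; apply: contraNneq jI => <-.
have i0j := neq_j _ i0I; have ji0 : j != i0 by rewrite eq_sym.
have [e_le e_eq] := edge i0j A0.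
have f_le := neighbour jI i0I A0.
case: (pselect (exists2 k, k \in I & (k != i0) && (A k j != 0))).
  case=> k kI /andP[ki0 Ak].
  have i0k : i0 != k by rewrite eq_sym.
  have [f2 a0] := two_neighbours jI i0I kI i0k A0 Ak fI.
  have sym' : {in j |: I &, forall i j, a i j = a j i}.
    apply: sym_setU1 => [|i iI]; first exact: a_sym.
    have [/A0'//|Ai] := eqVneq (A i j) 0.
    have [->//|ii0] := eqVneq i i0.
    by case: (two_neighbours jI iI i0I ii0 Ai A0 fI).
  split=> //; last exact: symmetrized_by_u.
  lra.
move=> no_k.
have A0k k : k \in I -> k != i0 -> A k j = 0.
  move=> kI ki0; apply/eqP; apply: contra_notT no_k => Ak.
  by exists k => //; rewrite ki0.
have Aj0 : A j i0 != 0 by apply: contra A0 => /eqP/A_sym0 ->.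
split; first lra.
  (* The single edge between [i0] and [j] dictates the value at [j]. *)
  pose d' k := if k == j then d i0 * (A i0 j)%:~R / (A j i0)%:~R else d k.
  have d'I i : i \in I -> d' i = d i.
    by move=> iI; rewrite /d' (negPf (neq_j _ iI)).
  exists d' => [i|].
    rewrite /d'; case: eqP => // _.
    rewrite nmulr_lgt0 ?invr_lt0 ?ltrz0 ?pmulr_rlt0 ?ltrz0 //.
      by rewrite lt_neqAle A0 A_le0.
    by rewrite lt_neqAle Aj0 A_le0.
  apply: sym_setU1 => [i k iI kI|i iI]; first by rewrite !d'I // d_sym.
  have [->|ii0] := eqVneq i i0.
    by rewrite d'I // /d' eqxx mulfVK // intr_eq0.
  by have Aij := A0k _ iI ii0; rewrite (A_sym0 _ _ Aij) Aij !mulr0.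
(* Since [f I] is at most 2 and the edge to [i0] contributes at most -2, the value 2 forces equality
   in both bounds. *)
move=> f2; apply: sym_setU1 => [|i iI]; first by apply: a_sym; lra.
have [->|ii0] := eqVneq i i0; first by apply: e_eq; lra.
by apply: A0'; apply: A0k.
Qed.

(** No classification of affine types is used: a vertex set grows one vertex at a time, along edges
    supplied by indecomposability, until it contains all vertices. *)
Lemma symmetrizable :
  exists2 d : 'I_n -> rat, forall i, 0 < d i
    & forall i j, d i * (A i j)%:~R = d j * (A j i)%:~R.
Proof.
have [n0|n_gt0] := posnP n.
  by exists (fun=> 1) => // i; have := ltn_ord i; rewrite {2}n0.
suff grow k : (k < n)%N -> exists2 I : {set 'I_n}, #|I| = k.+1 & symmetrized I.
  have [|I cI [_ [d d_gt0 d_sym] _]] := grow n.-1; first by rewrite prednK.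
  have IT : I = [set: 'I_n]%SET.
    by apply/eqP; rewrite eqEcard finset.subsetT cardsT card_ord cI prednK /=.
  by exists d => // i j; apply: d_sym; rewrite IT finset.in_setT.
elim: k => [_|k IHk kn].
  exists [set Ordinal n_gt0]%SET; first by rewrite cards1.
  have sym : {in [set Ordinal n_gt0]%SET &, forall i j, a i j = a j i}.
    by move=> i j /set1P-> /set1P->.
  split=> //; last exact: symmetrized_by_u.
  by rewrite /f !big_set1 a_diag.
have [I cI symI] := IHk (ltnW kn).
have [i iI] : exists i, i \in I by apply/card_gt0P; rewrite cI.
have [j jI] : exists j, j \notin I.
  have : (0 < #|~: I|)%N by rewrite cardsCs finset.setCK cI card_ord subn_gt0.
  by case/card_gt0P=> j; rewrite inE => ?; exists j.
have [i0 [j0 [i0I j0I A0]]] := A_ind (ex_intro _ i iI) (ex_intro _ j jI).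
exists (j0 |: I); first by rewrite cardsU1 j0I cI.
exact: symmetrized_setU1 A0 symI.
Qed.

End Symmetrization.

(** * The invariant form, reflections and real roots *)

Lemma gcm_simple n (A : 'M[int]_n) i :
  gcm A -> (A *m delta_mx i (0 : 'I_1)) i 0 = 2.
Proof. by case=> A2 _ _; rewrite -colE mxE A2. Qed.

Section InvariantForm.

Variables (n : nat) (A : 'M[int]_n) (d : 'I_n -> rat).

(** Here [d i] plays the role of half of (alpha_i, alpha_i); symmetry holds once [d] symmetrizes
    [A]. *)
Definition inv_form (x y : 'cV[int]_n) : rat :=
  \sum_i d i * (x i 0)%:~R * ((A *m y) i 0)%:~R.

Lemma inv_formDl x y z : inv_form (x + y) z = inv_form x z + inv_form y z.
Proof.
rewrite -big_split; apply: eq_bigr => i _.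
by rewrite /= mxE intrD mulrDr mulrDl.
Qed.

Lemma inv_formZl a x y : inv_form (a *: x) y = a%:~R * inv_form x y.
Proof.
rewrite mulr_sumr; apply: eq_bigr => i _.
by rewrite mxE intrM mulrCA !mulrA.
Qed.

Lemma inv_form_simple i y :
  inv_form (delta_mx i 0) y = d i * ((A *m y) i 0)%:~R.
Proof.
rewrite /inv_form (bigD1 i) //= big1 => [|j ji].
  by rewrite mxE !eqxx mulr1 addr0.
by rewrite mxE (negPf ji) mulr0 mul0r.
Qed.

Lemma inv_form_kerr x y : A *m y = 0 -> inv_form x y = 0.
Proof. by move=> Ay; apply: big1 => i _; rewrite Ay mxE mulr0. Qed.

Hypothesis d_gt0 : forall i, 0 < d i.
Hypothesis d_sym : forall i j, d i * (A i j)%:~R = d j * (A j i)%:~R.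

Lemma inv_form_sum x y :
  inv_form x y = \sum_i \sum_j d i * (A i j)%:~R * (x i 0)%:~R * (y j 0)%:~R.
Proof.
apply: eq_bigr => i _; rewrite mxE rmorph_sum mulr_sumr.
by apply: eq_bigr => j _; rewrite /= intrM; ring.
Qed.

Lemma inv_formC x y : inv_form x y = inv_form y x.
Proof.
rewrite !inv_form_sum exchange_big.
apply: eq_bigr => i _; apply: eq_bigr => j _.
by rewrite d_sym mulrAC.
Qed.

Lemma inv_formDr x y z : inv_form x (y + z) = inv_form x y + inv_form x z.
Proof. by rewrite inv_formC inv_formDl !(inv_formC x). Qed.

Lemma inv_formZr a x y : inv_form x (a *: y) = a%:~R * inv_form x y.
Proof. by rewrite inv_formC inv_formZl inv_formC. Qed.

Variable u : 'I_n -> rat.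
Hypothesis u_gt0 : forall i, 0 < u i.
Hypothesis Au0 : forall i, \sum_j (A i j)%:~R * u j = 0.
Hypothesis A_gcm : gcm A.

Let p (x : 'cV[int]_n) i := (x i 0)%:~R / u i.

(* As Au = 0, the form is a sum of squares with coefficients
   - d_i a_ij u_i u_j / 2, which are nonnegative for i <> j. *)
Let inv_form_squares x :
  \sum_i \sum_j d i * (A i j)%:~R * u i * u j * (p x i - p x j) ^+ 2
  = - 2 * inv_form x x.
Proof.
pose s i j := d i * (A i j)%:~R.
have su0 i : \sum_j s i j * u j = 0.
  by under eq_bigr do rewrite /s -mulrA; rewrite -mulr_sumr Au0 mulr0.
have s_sym i j : s i j = s j i by apply: d_sym.
have E i j : s i j * u i * u j * (p x i - p x j) ^+ 2 =
    p x i ^+ 2 * u i * (s i j * u j) + p x j ^+ 2 * u j * (s j i * u i)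
    - 2 * (s i j * (x i 0)%:~R * (x j 0)%:~R).
  rewrite (s_sym j i) /p; field.
  by rewrite !lt0r_neq0.
under eq_bigr do (under eq_bigr do rewrite E; rewrite !big_split /=).
rewrite !big_split /= [X in _ + X + _]exchange_big /=.
under [X in X + _ + _]eq_bigr do rewrite -mulr_sumr su0 mulr0.
under [X in _ + X + _]eq_bigr do rewrite -mulr_sumr su0 mulr0.
rewrite big1 // !add0r inv_form_sum mulr_sumr.
apply: eq_bigr => i _; rewrite mulr_sumr.
by apply: eq_bigr => j _; rewrite mulNr.
Qed.

Lemma inv_form_ge0 x : 0 <= inv_form x x.
Proof.
have [_ A_le0 _] := A_gcm.
suff : - 2 * inv_form x x <= 0 by lra.
rewrite -inv_form_squares; apply: sumr_le0 => i _; apply: sumr_le0 => j _.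
have [->|ij] := eqVneq i j; first by rewrite subrr expr0n mulr0.
rewrite mulr_le0_ge0 ?sqr_ge0 // pmulr_lle0 // pmulr_lle0 // pmulr_rle0 //.
by rewrite lerz0 A_le0.
Qed.

(* Positivity of the form at (Ax)_i alpha_i - 2x forces (Ax)_i = 0. *)
Lemma inv_form_eq0 x : inv_form x x = 0 -> A *m x = 0.
Proof.
move=> x0; apply/colP => i; rewrite [RHS]mxE.
set m := (A *m x) i 0.
have e2 : inv_form (delta_mx i 0) (delta_mx i 0) = d i * 2.
  by rewrite inv_form_simple gcm_simple //.
(* The norm of this vector is [2 * d i * (1 - 2 * m ^ 2)], negative for every nonzero integer
   [m]. *)
have := inv_form_ge0 (delta_mx i 0 + (- 2 * m) *: x).
rewrite !(inv_formDl, inv_formDr, inv_formZl, inv_formZr) x0 e2.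
rewrite (inv_formC x) inv_form_simple -/m intrM.
move: (d_gt0 i) => di ge0.
apply/eqP; apply: contraTT isT => m0.
have : (1 : rat) <= (m ^+ 2)%:~R.
  by rewrite ler1z -[1]add0r lezD1 exprn_even_gt0 // orbC m0.
rewrite rmorphXn /=; move: ge0; set t : rat := m%:~R => ge0 t1.
have := ler_pM2l di 1 (t ^+ 2); rewrite t1 => /idP; nra.
Qed.

Lemma simple_refl_inv_form i x y :
  inv_form (simple_refl A i x) (simple_refl A i y) = inv_form x y.
Proof.
rewrite /simple_refl -!scaleNr.
rewrite !(inv_formDl, inv_formDr, inv_formZl, inv_formZr).
rewrite (inv_formC x (delta_mx _ _)) !inv_form_simple gcm_simple //.
rewrite !rmorphN /=; ring.
Qed.

Lemma simple_reflB i x y a : simple_refl A i (x - a *: y) =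
  simple_refl A i x - a *: simple_refl A i y.
Proof.
have AE : (A *m (x - a *: y)) i 0 = (A *m x) i 0 - a * (A *m y) i 0.
  by rewrite mulmxBr -scalemxAr !mxE.
rewrite /simple_refl AE scalerBl scalerBr scalerA !opprB addrACA [RHS]addrACA.
by congr (_ + _); rewrite addrC.
Qed.

Lemma simple_reflK i : involutive (simple_refl A i).
Proof.
move=> x.
rewrite [X in simple_refl A i X]/simple_refl simple_reflB.
rewrite /simple_refl gcm_simple // scalerBr scalerA opprB -scalerBl.
by rewrite [X in _ + X *: _](_ : _ = (A *m x) i 0) ?subrK //; ring.
Qed.

Lemma real_root_refl i x : real_root A x -> real_root A (simple_refl A i x).
Proof. by case=> w [j ->]; exists (i :: w), j. Qed.

(* N is the coroot of x. *)
Lemma real_root_coroot x : real_root A x -> 0 < inv_form x x /\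
  exists N : 'cV[int]_n -> int, forall y,
    2 * inv_form x y = (N y)%:~R * inv_form x x /\
    (real_root A y -> real_root A (y - N y *: x)).
Proof.
case=> w [j ->]; elim: w => [|i w] /=.
  rewrite inv_form_simple gcm_simple //; split; first by rewrite mulr_gt0.
  exists (fun y => (A *m y) j 0) => y; split.
    by rewrite inv_form_simple; ring.
  exact: real_root_refl.
set x' := foldr (simple_refl A) (delta_mx j 0) w; case=> x_gt0 [N xN].
rewrite simple_refl_inv_form; split=> //.
(* Simple reflections preserve the form and the real roots, so the coroot of the reflected root at
   [y] is the coroot of [x'] at the reflection of [y]. *)
exists (fun y => N (simple_refl A i y)) => y.
have [eN rN] := xN (simple_refl A i y); split.
  by rewrite -eN -{1}[y](simple_reflK i) simple_refl_inv_form.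
move=> /(real_root_refl i)/rN/(real_root_refl i).
by rewrite simple_reflB simple_reflK.
Qed.

(** The coroot of [x] takes the value 2 on [x], so the reflection in [x] sends [x] to its
    opposite. *)
Lemma real_root_opp x : real_root A x -> real_root A (- x).
Proof.
move=> rx; have [x_gt0 [N xN]] := real_root_coroot rx.
have [e /(_ rx)] := xN x.
have /eqP : (2 : rat) = (N x)%:~R by apply: (mulIf (lt0r_neq0 x_gt0)).
rewrite -[2]/(2%:~R) eqr_int => /eqP <-.
by rewrite scaler_nat mulr2n opprD addrA subrr sub0r.
Qed.

End InvariantForm.

Lemma biggcdn_mull (I : finType) (g : nat) (F : I -> nat) :
  (\big[gcdn/0]_i (g * F i) = g * \big[gcdn/0]_i F i)%N.
Proof. by rewrite (big_morph (muln g) (muln_gcdr g) (muln0 g)). Qed.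

(** * Null vectors and imaginary roots *)

Section AffineNullspace.

Variables (n : nat) (A : 'M[int]_n).
Hypothesis A_aff : affine_gcm A.

(** Corank 1 makes the kernel a line, spanned by the positive vector [u]. *)
Lemma affine_null_vector (u : 'cV[rat]_n) (x : 'cV[int]_n) :
  (forall i, 0 < u i 0) -> rat_mx A *m u = 0 -> A *m x = 0 ->
  exists c : rat, forall i, (x i 0)%:~R = c * u i 0.
Proof.
move=> u_gt0 Au Ax; have [_ _ A_rank _ _] := A_aff.
pose K := kermx (rat_mx A)^T.
have rK : \rank K = 1%N.
  by rewrite mxrank_ker mxrank_tr -[X in (X - _)%N]A_rank subSnn.
have uK : (u^T <= K)%MS by rewrite sub_kermx -trmx_mul Au trmx0.
pose xQ : 'cV[rat]_n := map_mx intr x.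
have xK : (xQ^T <= K)%MS.
  by rewrite sub_kermx -trmx_mul /rat_mx -map_mxM Ax map_mx0 trmx0.
have n_gt0 : (0 < n)%N by rewrite -A_rank.
have u0 : u^T != 0.
  apply/negP=> /eqP/rowP/(_ (Ordinal n_gt0)); rewrite !mxE => u0.
  by have := u_gt0 (Ordinal n_gt0); rewrite u0 ltxx.
have /eqmxP uE : (u^T == K)%MS.
  by rewrite -(geq_leqif (mxrank_leqif_eq uK)) rK rank_rV u0.
have /sub_rVP[c xc] : (xQ^T <= u^T)%MS by rewrite uE.
by exists c => i; have /rowP/(_ i) := xc; rewrite !mxE.
Qed.

(** All coordinates of [x] have the sign of its ratio [c] to a positive null vector. Dividing [x] by
    this sign and by the gcd of its coordinates gives the primitive positive null vector. *)
Lemma null_vector_imaginary (x : 'cV[int]_n) :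
  A *m x = 0 -> x != 0 -> imaginary_root A x.
Proof.
move=> Ax x0; have [_ _ _ [u u_gt0 Au] _] := A_aff.
have [c xc] := affine_null_vector u_gt0 Au Ax.
have c0 : c != 0.
  apply: contraNneq x0 => c0; apply/eqP/colP => i; apply/eqP.
  by rewrite [X in _ == X]mxE -(intr_eq0 rat) xc c0 mul0r.
pose g := \big[gcdn/0%N]_i absz (x i 0).
pose s : int := sgz c.
have s0 : s != 0 by rewrite sgz_eq0.
have ss : s * s = 1 by rewrite /s; case: sgzP c0.
have sx_gt0 i : 0 < s * x i 0.
  rewrite -(ltr0z rat) intrM xc mulrA pmulr_lgt0 // /s.
  by case: sgzP c0 => // c_sgn _; rewrite ?mul1r ?mulN1r ?oppr_gt0.
pose y : 'cV[int]_n := \col_i (s * divz (x i 0) g).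
have xg i : x i 0 = g%:Z * divz (x i 0) g.
  by rewrite mulrC divzK // dvdzE /=; apply: biggcdn_inf (dvdnn _).
have g0 : (g : int) != 0.
  apply: contraNneq x0 => g0; apply/eqP/colP => i.
  by rewrite xg g0 mul0r mxE.
have xE : x = (s * g%:Z) *: y.
  by apply/colP => i; rewrite !mxE mulrACA ss mul1r -xg.
exists y; last by exists (s * g%:Z) => //; rewrite mulf_neq0.
split=> [|i|].
- apply/colP => i; move: Ax; rewrite {1}xE -scalemxAr => /colP/(_ i)/eqP.
  rewrite [X in X == _]mxE ![X in _ == X]mxE !mulf_eq0 (negPf s0) (negPf g0).
  by move/eqP->; rewrite mxE.
- have := sx_gt0 i; rewrite {1}xg mulrCA mxE pmulr_rgt0 //.
  by rewrite lt_neqAle eq_sym g0.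
- have g_gt0 : (0 < g)%N by rewrite lt0n.
  apply/eqP; rewrite -(eqn_pmul2l g_gt0) muln1 -biggcdn_mull; apply/eqP.
  apply: eq_bigr => i _; rewrite mxE {2}xg !abszM.
  have -> : absz s = 1%N by rewrite /s; case: sgzP c0.
  by rewrite mul1n.
Qed.

End AffineNullspace.

Lemma affine_positive_null n (A : 'M[int]_n) : affine_gcm A ->
  exists2 u : 'I_n -> rat, forall i, 0 < u i
    & forall i, \sum_j (A i j)%:~R * u j = 0.
Proof.
case=> _ _ _ [u u_gt0 Au] _; exists (fun i => u i 0) => // i.
have /colP/(_ i) := Au; rewrite !mxE => Aui; rewrite -[RHS]Aui.
by apply: eq_bigr => j _; rewrite mxE.
Qed.

Lemma km_roots_opp n (A : 'M[int]_n) x : affine_gcm A ->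
  km_roots A x -> km_roots A (- x).
Proof.
move=> A_aff [rx|[d dA [k k0 ->]]].
  have [A_gcm A_ind _ _ _] := A_aff.
  have [u u_gt0 Au0] := affine_positive_null A_aff.
  have [d d_gt0 d_sym] := symmetrizable A_gcm A_ind u_gt0 Au0.
  by left; exact: (real_root_opp d_gt0 d_sym).
by right; exists d => //; exists (- k); rewrite ?oppr_eq0 // scaleNr.
Qed.

(** * Sums of elements of a closed set, for an abstract semidefinite form *)

Section ClosedSubset.

Variables (T : zmodType) (R : realDomainType) (b : T -> T -> R).
Variables Phi S : set T.
Hypothesis bDl : forall x y z, b (x + y) z = b x z + b y z.
Hypothesis bC : forall x y, b x y = b y x.
Hypothesis b_eq0 : forall x y, b x x = 0 -> b x y = 0.
Hypothesis b_ge0 : forall x, 0 <= b x x.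
Hypothesis Phi_sub : forall x y, Phi x -> Phi y -> 0 < b x y ->
  x - y = 0 \/ Phi (x - y).
Hypothesis Phi_null : forall x y, Phi x -> Phi y -> b x x = 0 -> b y y = 0 ->
  x + y = 0 \/ Phi (x + y).
Hypothesis S_Phi : S `<=` Phi.
Hypothesis S_opp : forall x, S x -> S (- x).
Hypothesis S_closed : forall x y, S x -> S y -> Phi (x + y) -> S (x + y).

Let b0l y : b 0 y = 0.
Proof. by apply: (addrI (b 0 y)); rewrite -bDl !addr0. Qed.

Let bNr x y : b x (- y) = - b x y.
Proof. by apply/eqP; rewrite -addr_eq0 !(bC x) -bDl addNr b0l. Qed.

Let b_sumr x s : b x (\sum_(y <- s) y) = \sum_(y <- s) b x y.
Proof.
elim: s => [|y s IHs]; first by rewrite !big_nil bC b0l.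
by rewrite !big_cons bC bDl !(bC _ x) IHs.
Qed.

Let sum_gt0 (I : eqType) (s : seq I) (F : I -> R) :
  0 < \sum_(i <- s) F i -> exists2 i, i \in s & 0 < F i.
Proof.
move=> sum_gt0; apply/hasP; apply: contraTT sum_gt0 => /hasPn F_le0.
by rewrite -leNgt big_seq sumr_le0 // => i /F_le0; rewrite -leNgt.
Qed.

Let S0 x := x = 0 \/ S x.

Let closed_null_sum s : (forall x, x \in s -> S x) ->
  (forall x, x \in s -> b x x = 0) -> S0 (\sum_(x <- s) x).
Proof.
move=> sS s0.
(* The induction also carries isotropy of the partial sum, which [Phi_null] asks for. *)
suff [] : S0 (\sum_(x <- s) x) /\
  b (\sum_(x <- s) x) (\sum_(x <- s) x) = 0 by [].
elim: s sS s0 => [|x s IHs] sS s0.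
  by rewrite big_nil b0l; split=> //; left.
have sub y : y \in s -> y \in x :: s by rewrite inE orbC => ->.
have [sumS sum0] :=
  IHs (fun y ys => sS y (sub y ys)) (fun y ys => s0 y (sub y ys)).
rewrite !big_cons.
have Sx : S x by apply: sS; rewrite mem_head.
have x0 : b x x = 0 by apply: s0; rewrite mem_head.
set y := \sum_(_ <- _) _ in sumS sum0 *; split.
  case: sumS => [->|Sy]; first by rewrite addr0; right.
  have [|Pxy] := Phi_null (S_Phi Sx) (S_Phi Sy) x0 sum0; first by left.
  by right; apply: S_closed.
by rewrite bDl (b_eq0 _ x0) (b_eq0 _ sum0) addr0.
Qed.

(* Either a summand can be split off the sum, or two summands with negative
   product can be merged, or all the summands are isotropic. *)
Lemma closed_sum s : (forall x, x \in s -> S x) ->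
  Phi (\sum_(x <- s) x) -> S0 (\sum_(x <- s) x).
Proof.
move: {2}(size s) (leqnn (size s)) => m; elim: m s => [|m IHm] s.
  by rewrite leqn0 size_eq0 => /eqP-> _ _; left; rewrite big_nil.
move=> sm sS; set x := \sum_(_ <- _) _ => Px.
have sum_rem y : y \in s -> x = y + \sum_(z <- rem y s) z.
  by move=> ys; rewrite /x (perm_big _ (perm_to_rem ys)) big_cons.
have size_rem_le y : y \in s -> (size (rem y s) <= m)%N.
  by move=> ys; rewrite size_rem // -ltnS; case: (s) ys sm.
have := b_ge0 x; rewrite le_eqVlt eq_sym => /orP[/eqP x0|x_gt0]; last first.
  have [y ys xy] : exists2 y, y \in s & 0 < b x y.
    by apply: sum_gt0; rewrite -b_sumr.
  have Sy := sS _ ys.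
  have xyE : x - y = \sum_(z <- rem y s) z.
    by rewrite (sum_rem y) // addrC addKr.
  have [/subr0_eq->|Pxy] := Phi_sub Px (S_Phi Sy) xy; first by right.
  have : S0 (x - y).
    rewrite xyE; apply: IHm; rewrite -?xyE //; first exact: size_rem_le.
    by move=> z /mem_rem/sS.
  case=> [/subr0_eq->|Sxy]; right=> //.
  by rewrite -(subrK y x); apply: S_closed; rewrite ?subrK.
case: (pselect (exists2 y, y \in s & b y y != 0))
    => [[y ys y0]|no_real]; last first.
  apply: closed_null_sum => // y ys; apply/eqP.
  apply: contra_notT no_real => y0.
  by exists y.
have y_gt0 : 0 < b y y by rewrite lt_neqAle eq_sym y0 b_ge0.
(* The isotropic [x] is orthogonal to [y], so the products of [y] with the other summands add up to
   [- b y y], which is negative. *)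
have [z zs yz] : exists2 z, z \in rem y s & 0 < - b y z.
  apply: sum_gt0; rewrite sumrN -b_sumr.
  suff <- : b y y = - b y (\sum_(z <- rem y s) z) by [].
  apply/eqP; rewrite -addr_eq0 (bC y (\sum_(z <- _) z)) -bDl -sum_rem //.
  by rewrite (b_eq0 _ x0).
have [Sy Sz] : S y /\ S z by split; apply: sS => //; apply: mem_rem zs.
have PSyz : S0 (y + z).
  (* Closure of [S] under negation lets [y + z] be treated as the difference of [y] and [- z]. *)
  have := Phi_sub (S_Phi Sy) (S_Phi (S_opp Sz)); rewrite bNr opprK => /(_ yz).
  by case=> [->|Pyz]; [left | right; apply: S_closed].
pose t := rem z (rem y s).
have xE : x = y + z + \sum_(w <- t) w.
  by rewrite (sum_rem y) // (perm_big _ (perm_to_rem zs)) big_cons addrA.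
have tS w : w \in t -> S w by move=> /mem_rem/mem_rem/sS.
(* The inequality is strict to leave room for [y + z] as a new summand. *)
have t_lt : (size t < m)%N.
  by have := size_rem_le y ys; rewrite (size_rem zs); case: (rem y s) zs.
case: PSyz => [yz0|Syz].
  move: Px; rewrite xE yz0 add0r; apply: IHm => //; exact: ltnW.
move: Px; rewrite xE -(big_cons _ _ (y + z) t xpredT id).
apply: IHm => // w; rewrite inE => /orP[/eqP->//|]; exact: tS.
Qed.

End ClosedSubset.

(** * Differences and sums of affine roots *)

Section AffineRoots.

Variables (n : nat) (A : 'M[int]_n).
Implicit Types x y : 'cV[int]_n.
Hypothesis A_aff : affine_gcm A.

Variables d u : 'I_n -> rat.
Hypothesis d_gt0 : forall i, 0 < d i.
Hypothesis d_sym : forall i j, d i * (A i j)%:~R = d j * (A j i)%:~R.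
Hypothesis u_gt0 : forall i, 0 < u i.
Hypothesis Au0 : forall i, \sum_j (A i j)%:~R * u j = 0.

Let A_gcm : gcm A. Proof. by case: A_aff. Qed.

Let formx_ge0 x : 0 <= inv_form A d x x.
Proof. exact: (inv_form_ge0 d_gt0 d_sym u_gt0 Au0 A_gcm). Qed.

Let formx_eq0 x : inv_form A d x x = 0 -> A *m x = 0.
Proof. exact: (inv_form_eq0 d_gt0 d_sym u_gt0 Au0 A_gcm). Qed.

Lemma km_roots_neq0 x : km_roots A x -> x != 0.
Proof.
case=> [rx|[dl [_ dl_gt0 _] [k k0 ->]]].
  have [x_gt0 _] := real_root_coroot d_gt0 d_sym A_gcm rx.
  by apply: contraTneq x_gt0 => ->; rewrite inv_form_kerr ?mulmx0 // ltxx.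
have [_ _ A_rank _ _] := A_aff; have n_gt0 : (0 < n)%N by rewrite -A_rank.
apply/eqP => /colP/(_ (Ordinal n_gt0)); rewrite !mxE => /eqP.
by rewrite mulf_eq0 (negPf k0) /= gt_eqF.
Qed.

Lemma null_vector_root x : A *m x = 0 -> x = 0 \/ km_roots A x.
Proof.
have [->|x0] := eqVneq x 0; first by left.
by move=> Ax; right; right; apply: null_vector_imaginary.
Qed.

Lemma imaginary_root_null x : imaginary_root A x -> A *m x = 0.
Proof. by case=> dl [Adl _ _] [k _ ->]; rewrite -scalemxAr Adl scaler0. Qed.

(* If neither <x^vee, y> nor <y^vee, x> is 1, then both are at least 2, and
   x - y is isotropic. *)
Lemma km_roots_sub x y : km_roots A x -> km_roots A y -> 0 < inv_form A d x y ->
  x - y = 0 \/ km_roots A (x - y).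
Proof.
case=> [rx|/imaginary_root_null Ax]; last first.
  by rewrite inv_formC // inv_form_kerr // ltxx.
case=> [ry|/imaginary_root_null Ay]; last by rewrite inv_form_kerr // ltxx.
move=> xy_gt0.
have [x_gt0 [M xM]] := real_root_coroot d_gt0 d_sym A_gcm rx.
have [y_gt0 [N yN]] := real_root_coroot d_gt0 d_sym A_gcm ry.
have [eM /(_ ry) rM] := xM y; have [eN /(_ rx) rN] := yN x.
have M_gt0 : 0 < M y.
  by rewrite -(ltr0z rat) -(pmulr_lgt0 _ x_gt0) -eM mulr_gt0.
have N_gt0 : 0 < N x.
  by rewrite -(ltr0z rat) -(pmulr_lgt0 _ y_gt0) -eN mulr_gt0 // inv_formC.
have [M1|M1] := eqVneq (M y) 1.
  right; left; rewrite -opprB; apply: (real_root_opp d_gt0 d_sym A_gcm).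
  by rewrite M1 scale1r in rM.
have [N1|N1] := eqVneq (N x) 1.
  by right; left; rewrite N1 scale1r in rN.
have M2 : (2 : rat) <= (M y)%:~R.
  by rewrite (ler_int _ 2); case: (M y) M_gt0 M1 => [[|[]]|].
have N2 : (2 : rat) <= (N x)%:~R.
  by rewrite (ler_int _ 2); case: (N x) N_gt0 N1 => [[|[]]|].
(* Both (x, x) and (y, y) are at most (x, y), so the norm of [x - y] is at most 0. *)
apply: null_vector_root; apply: formx_eq0; apply/eqP.
rewrite eq_le formx_ge0 andbT -scaleN1r.
rewrite !(inv_formDl, inv_formZl, inv_formDr d_sym, inv_formZr d_sym).
rewrite (inv_formC d_sym y x).
rewrite (inv_formC d_sym y x) in eN.
have Mx := ler_wpM2r (ltW x_gt0) M2; have Ny := ler_wpM2r (ltW y_gt0) N2.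
rewrite -eM in Mx; rewrite -eN in Ny.
by rewrite rmorphN1; lra.
Qed.

(** This is [closed_sum] for the invariant form; its exceptional value 0 is excluded because roots
    are nonzero. *)
Lemma km_roots_closed_sum (S : set 'cV[int]_n) (s : seq 'cV[int]_n) :
  S `<=` km_roots A -> (forall x, S x -> S (- x)) ->
  (forall x y, S x -> S y -> km_roots A (x + y) -> S (x + y)) ->
  (forall x, x \in s -> S x) -> km_roots A (\sum_(x <- s) x) ->
  S (\sum_(x <- s) x).
Proof.
move=> S_sub S_opp S_closed sS rs.
suff [s0|//] : \sum_(x <- s) x = 0 \/ S (\sum_(x <- s) x).
  by have := km_roots_neq0 rs; rewrite s0 eqxx.
apply: (closed_sum (b := inv_form A d) (Phi := km_roots A)) => //.
- exact: inv_formDl.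
- exact: inv_formC.
- by move=> x y /formx_eq0 Ax; rewrite inv_formC // inv_form_kerr.
- exact: km_roots_sub.
- move=> x y _ _ /formx_eq0 Ax /formx_eq0 Ay.
  by apply: null_vector_root; rewrite mulmxDr Ax Ay addr0.
Qed.

End AffineRoots.

(** * Coordinates on the simple roots, root lattices and the equivalence *)

Section Zcomb.

Variables (V : zmodType) (n : nat) (P : 'I_n -> V).

Lemma zcombD x y : zcomb P (x + y) = zcomb P x + zcomb P y.
Proof. by rewrite -big_split; apply: eq_bigr => i _; rewrite mxE mulrzDr. Qed.

Lemma zcomb0 : zcomb P 0 = 0.
Proof. by apply: big1 => i _; rewrite mxE. Qed.

Lemma zcombN x : zcomb P (- x) = - zcomb P x.
Proof. by apply/eqP; rewrite -addr_eq0 -zcombD addNr zcomb0. Qed.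

Lemma zcomb_inj : zfree P -> injective (zcomb P).
Proof.
move=> P_free x y xy; apply/subr0_eq/P_free.
by rewrite zcombD zcombN xy subrr.
Qed.

End Zcomb.

Lemma affine_root_system_opp (V : zmodType) (Delta : set V) v :
  affine_root_system Delta -> Delta v -> Delta (- v).
Proof.
case=> n [A [P [A_aff _ ->]]] [x rx <-]; rewrite -zcombN.
by exists (- x) => //; apply: km_roots_opp.
Qed.

(* Multiples are unfolded into repeated summands. *)
Lemma root_lattice_seq (V : zmodType) (Delta : set V) v :
  (forall w, Delta w -> Delta (- w)) -> root_lattice Delta v ->
  exists2 s : seq V, forall w, w \in s -> Delta w & v = \sum_(w <- s) w.
Proof.
move=> Delta_opp [m [r [c [rD ->]]]].
have mul_seq w (k : int) : Delta w ->
    exists2 s : seq V, forall w, w \in s -> Delta w & w *~ k = \sum_(w <- s) w.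
  move=> Dw; case: k => k.
    exists (nseq k w) => [z /nseqP[->]//|].
    by rewrite big_nseq iter_addr_0.
  exists (nseq k.+1 (- w)) => [z /nseqP[->] _|]; first exact: Delta_opp.
  by rewrite big_nseq iter_addr_0 mulNrn.
elim/big_ind: _ => [|x y [s sD ->] [t tD ->]|i _].
- by exists [::]; rewrite ?big_nil.
- exists (s ++ t); last by rewrite big_cat.
  by move=> w; rewrite mem_cat => /orP[/sD|/tD].
- exact: mul_seq.
Qed.

Lemma sub_root_lattice (V : zmodType) (Delta : set V) :
  Delta `<=` root_lattice Delta.
Proof.
by move=> v Dv; exists 1%N, (fun=> v), (fun=> 1); rewrite big_ord1.
Qed.

Lemma root_latticeD (V : zmodType) (Delta : set V) v w :
  Delta v -> Delta w -> root_lattice Delta (v + w).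
Proof.
move=> Dv Dw; exists 2%N, (fun i => if i == ord0 then v else w), (fun=> 1).
by split=> [i|]; [case: ifP | rewrite big_ord_recl big_ord1].
Qed.

Theorem theorem4p4 (V : zmodType) (Delta Delta1 : set V)
  (hDelta : affine_root_system Delta)
  (hDelta1 : affine_root_system Delta1)
  (hsub : Delta1 `<=` Delta) :
  root_subsystem Delta Delta1 <-> Delta1 = Delta `&` root_lattice Delta1.
Proof.
split=> [[_ closed1]|D1E]; last first.
  split=> // v w D1v D1w Dvw; rewrite D1E; split=> //.
  exact: root_latticeD.
apply/seteqP; split=> [v D1v|v [Dv L1v]].
  by split; [apply: hsub | apply: sub_root_lattice].
(* That [Delta1] is itself affine enters here: its opposites make the lattice element a plain sum of
   roots. *)
have opp1 w : Delta1 w -> Delta1 (- w) by apply: affine_root_system_opp.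
have [s sD1 vE] := root_lattice_seq opp1 L1v.
case: hDelta => n [A [P [A_aff P_free DE]]]; subst Delta.
have P_inj := zcomb_inj P_free.
have [A_gcm A_ind _ _ _] := A_aff.
have [u u_gt0 Au0] := affine_positive_null A_aff.
have [d d_gt0 d_sym] := symmetrizable A_gcm A_ind u_gt0 Au0.
(* The summands lie in [Delta], so the whole decomposition lifts to coordinate columns, where the
   form lives. *)
have [t ts] : exists t, s = map (zcomb P) t.
  elim: s sD1 {vE} => [|w s IHs] sD1; first by exists [::].
  have [|t ->] := IHs; first by move=> z zs; apply: sD1; rewrite inE zs orbT.
  by have [|x _ <-] := hsub w; [apply: sD1; rewrite mem_head | exists (x :: t)].
case: Dv => x rx xv.
have xE : x = \sum_(y <- t) y.
  apply: P_inj; rewrite xv vE ts big_map.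
  by rewrite (big_morph (zcomb P) (zcombD P) (zcomb0 P)).
have S_sub : zcomb P @^-1` Delta1 `<=` km_roots A.
  by move=> y /hsub [z rz /P_inj <-].
rewrite -xv xE.
(* The closed set is the preimage of [Delta1] in coordinates; freeness of [P] places it inside
   [km_roots A]. *)
apply: (km_roots_closed_sum A_aff d_gt0 d_sym u_gt0 Au0 S_sub) => [y||y yt|].
- by rewrite /preimage /= zcombN => /opp1.
- move=> y z Dy Dz ryz; rewrite /preimage /= zcombD; apply: closed1 => //.
  by exists (y + z); rewrite ?zcombD.
- by apply: sD1; rewrite ts map_f.
- by rewrite -xE.
Qed.
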